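(* Let $b\ge2$ and $n\ge1$ be integers and let $p=1$. Let $\{\kappa_r^-\}_{r\ge0}$ be the $(-b,n,1)$-carries process with $\kappa_0^-=0$, and let $\{\tilde\sigma_r\}_{r\ge0}$ be the Markov chain on $S_n$ with $\tilde\sigma_0=\mathrm{id}$ in which each step consists of applying a $(+b,n,1)$-shuffle followed by the reversal $R_1$, i.e. $\tilde\sigma_r=(S_1^-)^r\,\mathrm{id}$ with $S_1^-:=R_1\circ\big((+b,n,1)\text{-shuffle}\big)$. Then the processes $\{\kappa_r^-\}_{r\ge0}$ and $\{d(\tilde\sigma_r)\}_{r\ge0}$ have the same distribution.
   Context: Carries process: $\mathcal D(b)=\{0,1,\dots,b-1\}$. The $(-b,n,1)$-carries process is the Markov chain on $\{0,1,\dots,n-1\}$ in which, given $\kappa^-_{k-1}$, one draws $Y_1,\dots,Y_n$ independently and uniformly from $\mathcal D(b)$ (independently of the past), and $\kappa^-_k$ is determined by $\kappa^-_{k-1}+Y_1+\dots+Y_n+b=(n-\kappa_k^-)\,b+s$ with $s\in\mathcal D(b)$. Shuffle: for ${\bf A}=(a_1,\dots,a_n)\in\mathcal D(b)^n$ let $\pi_b[{\bf A}]=\sigma\in S_n$ be given by $\sigma(i)=\sharp\{j:a_j<a_i\}+\sharp\{j\le i:a_j=a_i\}$. A $(+b,n,1)$-shuffle (the usual $b$-riffle shuffle) is the random permutation $\pi_b[{\bf A}]$ with ${\bf A}$ uniform on $\mathcal D(b)^n$; applying it to $\sigma$ gives $\pi_b[{\bf A}]\circ\sigma$, and successive shuffles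 are independent. Reversal: for $\sigma\in S_n$, $(R_1\sigma)(k):=n+1-\sigma(k)$, $k=1,\dots,n$. Thus $\tilde\sigma_r=R_1\big(\pi_b[{\bf A}_r]\circ\tilde\sigma_{r-1}\big)$ with ${\bf A}_1,{\bf A}_2,\dots$ independent and uniform on $\mathcal D(b)^n$. $d(\sigma)=\sharp\{i\in\{1,\dots,n-1\}:\sigma(i)>\sigma(i+1)\}$ is the number of descents of $\sigma\in S_n$. *)

(* Defs.v *)
From mathcomp Require Import all_boot all_order all_fingroup all_algebra.
From mathcomp Require Import all_classical all_reals all_analysis.
From mathcomp Require Import zify.
Set Implicit Arguments.
Unset Strict Implicit.
Unset Printing Implicit Defensive.
Local Open Scope classical_set_scope.

(* F carries the discrete sigma-algebra, so every B i is an event. *)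
Definition mutually_independent d (T : measurableType d) (R : realType)
    (P : probability T R) (I : eqType) (F : finType) (X : I -> T -> F) : Prop :=
  forall (s : seq I) (B : I -> set F), uniq s ->
    P (\bigcap_(i in [set` s]) (X i @^-1` B i)) =
    (\prod_(i <- s) P (X i @^-1` B i))%E.

Definition iid_uniform d (T : measurableType d) (R : realType)
    (P : probability T R) (I : eqType) (F : finType) (X : I -> T -> F) : Prop :=
  [/\ forall i x, measurable (X i @^-1` [set x]),
      forall i x, P (X i @^-1` [set x]) = ((#|F|%:R : R)^-1%R)%:E
    & mutually_independent P X].

(* The product sigma-algebra on nat^nat, each factor nat being discrete. *)
Definition path_sigma_algebra : set (set (nat -> nat)) :=
  <<s [set C | exists (r : nat) (B : set nat), C = [set x | B (x r)]] >>.

Definition same_process_law (R : realType)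
    d (T : measurableType d) (P : probability T R) (X : nat -> T -> nat)
    d' (T' : measurableType d') (Q : probability T' R) (Z : nat -> T' -> nat)
    : Prop :=
  forall C, path_sigma_algebra C ->
    P [set w | C (fun r => X r w)] = Q [set w | C (fun r => Z r w)].

Section Carries.
Variables (b n : nat).
Local Open Scope nat_scope.

Definition neg_carries_step (k : 'I_n) (y : 'I_n -> 'I_b) (k' : 'I_n) : Prop :=
  exists s : 'I_b, k + \sum_(i < n) y i + b = (n - k') * b + s.

(* The new carry exists and is unique, so the relation above is a function
   of the old carry and of the digits. *)
Lemma neg_carries_step_unique (k : 'I_n) (y : 'I_n -> 'I_b) :
  0 < b -> exists! k' : 'I_n, neg_carries_step k y k'.
Proof.
move=> b0; have kn := ltn_ord k; have n0 : 0 < n by lia.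
set S := \sum_(i < n) y i.
have hS : S <= n * b.-1.
  rewrite /S -[n in n * _]card_ord -sum_nat_const.
  by apply: leq_sum => i _; rewrite -ltnS prednK.
have hSn : k + S + b < n.+1 * b.
  by rewrite mulSn; move: hS; case: (b) b0 => // c _ /=; rewrite mulnS; lia.
set q := (k + S + b) %/ b.
have hdiv := divn_eq (k + S + b) b; have hmod := ltn_pmod (k + S + b) b0.
have q_gt0 : 0 < q by rewrite divn_gt0 //; lia.
have q_le : q <= n.
  by rewrite -ltnS ltn_divLR.
have hk' : n - q < n by lia.
exists (Ordinal hk'); split.
  exists (Ordinal hmod) => /=.
  by rewrite subKn.
move=> k' [s hs]; apply: val_inj => /=.
rewrite /q hs divnMDl // divn_small ?ltn_ord // addn0 subKn //.
exact: ltnW (ltn_ord k').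
Qed.

(* Y (r, i) is the digit added in row i when passing from time r to r+1. *)
Definition neg_carries_process d (T : measurableType d) (R : realType)
    (P : probability T R) (kappa : nat -> T -> 'I_n) : Prop :=
  exists Y : nat * 'I_n -> T -> 'I_b,
    [/\ iid_uniform P Y,
        forall w, kappa 0 w = 0 :> nat
      & forall r w, neg_carries_step (kappa r w) (fun i => Y (r, i) w)
                                     (kappa r.+1 w)].

End Carries.

Section Shuffle.
Variables (b n : nat).
Local Open Scope nat_scope.

(* Positions and values run over 0, ..., n-1 instead of 1, ..., n; removing
   j = i from #{j <= i : a_j = a_i} accounts for the shift of the value. *)
Definition shuffle_rank (a : {ffun 'I_n -> 'I_b}) (i : 'I_n) : nat :=
  #|[pred j | a j < a i]| + #|[pred j : 'I_n | (j < i) && (a j == a i)]|.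

Lemma shuffle_rankE (a : {ffun 'I_n -> 'I_b}) (i : 'I_n) :
  shuffle_rank a i =
  #|[pred j | (a j < a i) || ((j < i) && (a j == a i))]|.
Proof.
rewrite /shuffle_rank -cardUI [X in _ + X]eq_card0 ?addn0.
  by apply: eq_card => j; rewrite !inE.
by move=> j; rewrite !inE; case: eqP => [->|]; rewrite ?ltnn ?andbF.
Qed.

Lemma shuffle_rank_lt (a : {ffun 'I_n -> 'I_b}) (i : 'I_n) :
  shuffle_rank a i < n.
Proof.
rewrite shuffle_rankE -[X in _ < X]card_ord; apply: proper_card.
by apply/properP; split; [exact: subset_predT | exists i; rewrite // !inE !ltnn].
Qed.

Lemma shuffle_rank_inj (a : {ffun 'I_n -> 'I_b}) :
  injective (fun i => Ordinal (shuffle_rank_lt a i)).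
Proof.
have mono i j : (a i < a j) || ((i < j) && (a i == a j)) ->
    shuffle_rank a i < shuffle_rank a j.
  move=> hij; rewrite !shuffle_rankE; apply: proper_card.
  apply/properP; split; last by exists i; rewrite !inE ?ltnn.
  by apply/fintype.subsetP => k; rewrite !inE -!val_eqE /=; move: hij; rewrite -!val_eqE /=; lia.
move=> i j [] eq_rank; apply: val_inj => /=.
have nij := mono i j; have nji := mono j i; move: nij nji.
by rewrite eq_rank ltnn -!val_eqE /=; lia.
Qed.

Definition shuffle_perm (a : {ffun 'I_n -> 'I_b}) : 'S_n :=
  perm (@shuffle_rank_inj a).

(* R_1; in 0-based notation n + 1 - v becomes n - 1 - v. *)
Definition reversal (sigma : 'S_n) : 'S_n :=
  (sigma * perm (@rev_ord_inj n))%g.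

Lemma reversalE (sigma : 'S_n) (k : 'I_n) :
  reversal sigma k = n.-1 - sigma k :> nat.
Proof. by rewrite permM permE /= subnS; lia. Qed.

(* In {perm _}, (s * t) i = t (s i): the product sigma_r * pi below is
   pi \o sigma_r. *)
Definition rev_shuffle_process d (T : measurableType d) (R : realType)
    (P : probability T R) (sigma : nat -> T -> 'S_n) : Prop :=
  exists A : nat -> T -> {ffun 'I_n -> 'I_b},
    [/\ iid_uniform P A,
        forall w, sigma 0 w = 1%g
      & forall r w, sigma r.+1 w =
                    reversal (sigma r w * shuffle_perm (A r w))%g].

End Shuffle.

Definition descents n (sigma : 'S_n) : nat :=
  #|[pred i : 'I_n | [exists j : 'I_n,
       (j == i.+1 :> nat) && (sigma j < sigma i)%N]]|.

(* Main.v *)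
Require Import Defs.
From mathcomp Require Import all_boot all_order all_fingroup all_algebra.
From mathcomp Require Import all_classical all_reals all_analysis.
From mathcomp Require Import zify.

(** Both processes are the same deterministic function of a sequence of rows
    of n digits, and in both cases these rows are independent and uniform.

    On the carries side, add the n digits of a row one after the other instead
    of all at once.  Each of the n - 1 elementary additions has its own carry
    bit: if u and w are the digits of two consecutive partial sums in a
    column and c is the bit coming from the previous column, the negative base
    turns the bit of the addition into its complement, so that the new bit is
    1 iff there is no overflow, i.e. iff u + c <= w.  The carry kappa_r is the
    sum of these bits (neg_carries_step_bits), and for fixed incoming bits the
    row of partial-sum digits is an injective function of the row of added
    digits (prefix_digits_inj).

    On the shuffle side, reread the digits of A_r in the order of the
    positions: let B_r(i) := A_r(sigma_r(i)).  The shuffle sorts the positions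
    by the pairs (B_r(i), sigma_r(i)) in lexicographic order, and the reversal
    exchanges ascents and descents; hence there is a descent at i after the
    step iff B_r(i) < B_r(i+1), or B_r(i) = B_r(i+1) and there was no descent
    at i before.  If c is the old descent bit this says B_r(i) + c <=
    B_r(i+1): it is the recurrence of the carry bits (descent_bit_step).

    In each case the rows driving the bits come from i.i.d. uniform rows by
    injective maps chosen according to the past, so prescribing the first r of
    them amounts to prescribing the first r original rows, and they are
    uniform again (uniform_paths_recode).  Two observables that depend in the
    same way on the first r rows then have equal laws on the events of bounded
    horizon, and these form a pi-system generating the path sigma-algebra
    (uniform_paths_same_law). *)

Set Implicit Arguments.
Unset Strict Implicit.
Unset Printing Implicit Defensive.

(** * Recursions driven by a sequence *)

Fixpoint run (S F : Type) (g : S -> F -> S) (s0 : S) (x : nat -> F) (r : nat)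
    : S :=
  if r is r'.+1 then g (run g s0 x r') (x r') else s0.

Lemma eq_run (S F : Type) (g : S -> F -> S) (s0 : S) (x y : nat -> F) (r : nat) :
  (forall i, (i < r)%N -> x i = y i) -> run g s0 x r = run g s0 y r.
Proof.
elim: r => //= r IHr exy; rewrite exy ?ltnSn // IHr // => i ir.
by rewrite exy // ltnS ltnW.
Qed.

(** * Processes with independent uniform values *)

Local Open Scope classical_set_scope.

Definition cylinder (T F : Type) (X : nat -> T -> F) (r : nat) (x : nat -> F)
    : set T :=
  [set w | forall i, (i < r)%N -> X i w = x i].

(** Independence is encoded by the probabilities of cylinders because recoding
    the values maps cylinders to cylinders, whereas it does not map the events
    of a single coordinate to such events. *)
Definition uniform_paths d (T : measurableType d) (R : realType)
    (P : probability T R) (F : finType) (X : nat -> T -> F) : Prop :=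
  forall r x, measurable (cylinder X r x) /\
    P (cylinder X r x) = (((#|F|%:R : R)^-1 ^+ r)%R)%:E.

Lemma iid_uniform_point d (T : measurableType d) (R : realType)
    (P : probability T R) (I : eqType) (F : finType) (X : I -> T -> F)
    (s : seq I) (x : I -> F) : iid_uniform P X -> uniq s ->
  measurable (\bigcap_(i in [set` s]) (X i @^-1` [set x i])) /\
  P (\bigcap_(i in [set` s]) (X i @^-1` [set x i])) =
    (((#|F|%:R : R)^-1 ^+ size s)%R)%:E.
Proof.
move=> [mX unifX indX] us; split.
  by apply: fin_bigcap_measurable => [|i _]; [exact: finite_seq | exact: mX].
rewrite (indX s (fun i => [set x i])) //.
under eq_bigr do rewrite unifX.
elim: s {us} => [|i s IHs]; first by rewrite big_nil.
by rewrite big_cons IHs /= GRing.exprS EFinM.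
Qed.

Lemma iid_uniform_paths d (T : measurableType d) (R : realType)
    (P : probability T R) (F : finType) (X : nat -> T -> F) :
  iid_uniform P X -> uniform_paths P X.
Proof.
move=> iidX r x; have := iid_uniform_point x iidX (iota_uniq 0 r).
rewrite size_iota; congr (measurable _ /\ P _ = _); apply/seteqP.
all: split=> w hw i /=; rewrite ?mem_iota ?add0n => ir; apply: hw => //=;
  by rewrite mem_iota.
Qed.

Lemma iid_uniform_rows d (T : measurableType d) (R : realType)
    (P : probability T R) (J F : finType) (Y : nat * J -> T -> F) :
  iid_uniform P Y ->
  uniform_paths P (fun r w => [ffun i => Y (r, i) w] : {ffun J -> F}).
Proof.
move=> iidY r x; pose s := [seq (k, i) | k <- iota 0 r, i <- enum J].
have us : uniq s.
  apply: allpairs_uniq; [exact: iota_uniq|exact: enum_uniq|].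
  by move=> [? ?] [? ?].
have in_s k i : ((k, i) \in s) = (k < r)%N.
  apply/allpairsP/idP => [[[k' i'] /= [+ _ [-> _]]]|kr].
    by rewrite mem_iota add0n.
  by exists (k, i); rewrite /= mem_iota add0n mem_enum.
have := iid_uniform_point (fun ki => x ki.1 ki.2) iidY us.
rewrite size_allpairs size_iota -cardE card_ffun GRing.natrX -GRing.exprVn.
rewrite mulnC GRing.exprM.
congr (measurable _ /\ P _ = _); apply/seteqP; split=> w hw.
- by move=> k kr; apply/ffunP => i; rewrite ffunE (hw (k, i)) //= in_s.
- by move=> [k i]; rewrite /= in_s => /hw/ffunP/(_ i); rewrite ffunE.
- by move=> k kr; apply/ffunP => i; rewrite ffunE (hw (k, i)) //= in_s.
- by move=> [k i]; rewrite /= in_s => /hw/ffunP/(_ i); rewrite ffunE.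
Qed.

(** Injectivity makes the recoding invertible along a prescribed path x: the
    state before step r is then known, so the value x r of W r comes from
    exactly one value y r of X r.  Thus each cylinder of W is a cylinder of X
    of the same length. *)
Lemma uniform_paths_recode d (T : measurableType d) (R : realType)
    (P : probability T R) (F : finType) (X W : nat -> T -> F)
    (S : Type) (g : S -> F -> S) (s0 : S) (phi : S -> F -> F) :
  (forall s, injective (phi s)) ->
  (forall r w, W r w = phi (run g s0 (W ^~ w) r) (X r w)) ->
  uniform_paths P X -> uniform_paths P W.
Proof.
move=> phi_inj WE unifX r x.
pose y k := invF (phi_inj (run g s0 x k)) (x k).
rewrite (_ : cylinder W r x = cylinder X r y); first exact: unifX.
apply/seteqP; rewrite /cylinder; elim: r => [|r [IHW IHX]]; first by split.
have step w : (forall i, (i < r)%N -> W i w = x i) -> (W r w = x r <-> X r w = y r).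
  move=> eq_Wx; rewrite WE (eq_run _ _ eq_Wx) /y; split=> [<-|->].
    by rewrite invF_f.
  by rewrite f_invF.
split=> w hw i; rewrite ltnS leq_eqVlt => /predU1P[->|ir].
- by apply/step => [j jr|]; apply: hw; rewrite // ltnS ltnW.
- by apply: IHW ir => j jr; apply: hw; rewrite ltnS ltnW.
- apply/step => [j jr|]; last exact: hw.
  by apply: IHX jr => k kr; apply: hw; rewrite ltnS ltnW.
- by apply: IHX ir => j jr; apply: hw; rewrite ltnS ltnW.
Qed.

(** The events of bounded horizon. *)
Definition depends_on_first (A : Type) (r : nat) (E : set (nat -> A)) : Prop :=
  forall x y, (forall i, (i < r)%N -> x i = y i) -> E x -> E y.

(** The right-hand side mentions only F, r and E, so it is the same for any two
    uniform processes, even on different probability spaces. *)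
Lemma uniform_paths_event d (T : measurableType d) (R : realType)
    (P : probability T R) (F : finType) (X : nat -> T -> F)
    (r : nat) (E : set (nat -> F)) :
  uniform_paths P X -> depends_on_first r E ->
  measurable [set w | E (X ^~ w)] /\
  P [set w | E (X ^~ w)] =
    (\sum_(t \in [set [tuple x i | i < r] | x in E])
       (((#|F|%:R : R)^-1 ^+ r)%R)%:E)%E.
Proof.
move=> unifX depE; set D := [set _ | x in E].
pose slice (t : r.-tuple F) := [set w | [tuple X i w | i < r] = t].
have sliceE t : D t -> exists x, slice t = cylinder X r x.
  move=> [x _ <-]; exists x; apply/seteqP; split=> w.
    move=> /= eq_Xx i ir.
    by have := congr1 (fun t => tnth t (Ordinal ir)) eq_Xx; rewrite !tnth_mktuple.
  by move=> eq_Xx; apply: eq_mktuple => i; exact: eq_Xx.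
have -> : [set w | E (X ^~ w)] = \bigcup_(t in D) slice t.
  apply/seteqP; split=> w /=.
    by move=> Ew; exists [tuple X i w | i < r] => //; exists (X ^~ w).
  move=> [_ [x Ex <-]] /= eq_Xx; apply: depE Ex => i ir.
  by have := congr1 (fun t => tnth t (Ordinal ir)) eq_Xx; rewrite !tnth_mktuple.
have mslice t : D t -> measurable (slice t).
  by move=> /sliceE[x ->]; exact: (unifX r x).1.
split; first exact: fin_bigcup_measurable.
have finD : finite_set D by exact: finite_finset.
rewrite measure_fin_bigcup //.
  by apply: eq_fsbigr => t /set_mem /sliceE[x ->]; exact: (unifX r x).2.
by move=> s t _ _ [w [/= <- <-]].
Qed.

(** The events on which the two laws agree form a Dynkin system, and the events
    of bounded horizon are stable under intersection and generate the path
    sigma-algebra. *)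
Lemma uniform_paths_same_law (R : realType) d (T : measurableType d)
    (P : probability T R) d' (T' : measurableType d') (Q : probability T' R)
    (F : finType) (X : nat -> T -> F) (Z : nat -> T' -> F)
    (obs : (nat -> F) -> nat -> nat) :
  (forall r x y, (forall i, (i < r)%N -> x i = y i) -> obs x r = obs y r) ->
  uniform_paths P X -> uniform_paths Q Z ->
  same_process_law P (fun r w => obs (X ^~ w) r) Q (fun r w => obs (Z ^~ w) r).
Proof.
move=> obs_dep unifX unifZ.
pose past : set (set (nat -> nat)) := [set C | exists r, depends_on_first r C].
pose agree : set (set (nat -> nat)) := [set C |
  [/\ measurable [set w | C (obs (X ^~ w))], measurable [set w | C (obs (Z ^~ w))]
    & P [set w | C (obs (X ^~ w))] = Q [set w | C (obs (Z ^~ w))]]].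
have sub_past : path_sigma_algebra `<=` <<s past >>.
  apply: smallest_sub; first exact: smallest_sigma_algebra.
  move=> _ [r [B ->]]; apply: sub_sigma_algebra; exists r.+1 => x y.
  by move=> /(_ r (ltnSn r)) /= ->.
have past_setI : setI_closed past.
  move=> A B [r depA] [s depB]; exists (maxn r s) => x y eq_xy [Ax Bx]; split.
    by apply: depA Ax => i ir; apply: eq_xy; rewrite leq_max ir.
  by apply: depB Bx => i ir; apply: eq_xy; rewrite leq_max ir orbT.
have past_agree : past `<=` agree.
  move=> C [r depC].
  have dep : depends_on_first r [set x | C (obs x)].
    move=> x y eq_xy; apply: depC => i ir; apply: obs_dep => j ji.
    by apply: eq_xy; exact: ltn_trans ir.
  have [mX PX] := uniform_paths_event unifX dep.
  have [mZ QZ] := uniform_paths_event unifZ dep.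
  by split=> //; exact: etrans PX (esym QZ).
have agree_dynkin : dynkin agree.
  split=> [|A [mX mZ eqPQ]|A disjA agA].
  - by apply: past_agree; exists 0.
  - split; [exact: measurableC mX|exact: measurableC mZ|].
    rewrite (probability_setC _ mX) (probability_setC _ mZ).
    by congr (_ - _)%E; exact: eqPQ.
  - have disj U (f : U -> nat -> nat) : trivIset setT (fun k => [set w | A k (f w)]).
      by move=> i j _ _ [w [/= ? ?]]; apply: disjA => //; exists (f w).
    have mX i : measurable [set w | A i (obs (X ^~ w))] by case: (agA i).
    have mZ i : measurable [set w | A i (obs (Z ^~ w))] by case: (agA i).
    have mUX : measurable (\bigcup_k [set w | A k (obs (X ^~ w))]).
      exact: bigcup_measurable.
    have mUZ : measurable (\bigcup_k [set w | A k (obs (Z ^~ w))]).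
      exact: bigcup_measurable.
    split=> //.
    have -> : P [set w | (\bigcup_k A k) (obs (X ^~ w))] = _ :=
      measure_semi_bigcup P mX (disj _ _) mUX.
    apply: etrans _ (esym (measure_semi_bigcup Q mZ (disj _ _) mUZ)).
    by apply: eq_eseriesr => i _; case: (agA i).
move=> C /sub_past; rewrite -setI_closed_g_dynkin_g_sigma_algebra // => sC.
by case: (sC agree).
Qed.

(** * The bits *)

Local Open Scope nat_scope.

(** Indexing a row by nat lets i and i.+1 be used without casts; an index above
    m reads the digit at 0. *)
Definition digit (b m : nat) (a : {ffun 'I_m.+1 -> 'I_b}) (k : nat) : nat :=
  a (inord k).

(** The recurrence common to carries and descents.  Bit i
    belongs to the digits i and i + 1, so a row has the m bits below m. *)
Definition next_bits (b m : nat) (c : nat -> bool)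
    (a : {ffun 'I_m.+1 -> 'I_b}) : nat -> bool :=
  fun i => digit a i + c i <= digit a i.+1.

Definition bits (b m : nat) (x : nat -> {ffun 'I_m.+1 -> 'I_b}) (r : nat)
    : nat -> bool :=
  run (@next_bits b m) xpred0 x r.

(** * Descents of the reversed shuffles *)

(** The rank of i counts the lexicographic predecessors of i, so the ranks are
    ordered by proper inclusion of the sets of predecessors. *)
Lemma shuffle_rank_ltE (b n : nat) (a : {ffun 'I_n -> 'I_b}) (i j : 'I_n) :
  (shuffle_rank a i < shuffle_rank a j) =
  (a i < a j) || (i < j) && (a i == a j).
Proof.
have mono k l : (a k < a l) || (k < l) && (a k == a l) ->
    shuffle_rank a k < shuffle_rank a l.
  move=> hkl; rewrite !shuffle_rankE; apply: proper_card.
  apply/properP; split; last by exists k; rewrite !inE ?ltnn.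
  apply/fintype.subsetP => h; rewrite !inE -!val_eqE /=.
  by move: hkl; rewrite -!val_eqE /=; lia.
apply/idP/idP => [lt_ij|]; last exact: mono.
apply: contraTT lt_ij => not_ij; rewrite -leqNgt.
have [->//|neq_ij] := eqVneq i j.
apply/ltnW/mono; move: not_ij neq_ij; rewrite -!val_eqE /=; lia.
Qed.

Definition descent_bit (m : nat) (s : 'S_m.+1) (i : nat) : bool :=
  s (inord i.+1) < s (inord i).

Lemma descentsE (m : nat) (s : 'S_m.+1) :
  descents s = \sum_(i < m) descent_bit s i.
Proof.
rewrite /descents -sum1_card big_mkcond /= big_ord_recr /=.
(* The last position has no successor, hence no descent. *)
rewrite [X in _ + X](_ : _ = 0) ?addn0; last first.
  rewrite inE; case: ifP => // /existsP[j /andP[/eqP]] /= hj.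
  by have := ltn_ord j; rewrite hj ltnn.
apply: eq_bigr => i _; rewrite inE /descent_bit.
have -> : inord i = widen_ord (leqnSn m) i.
  by apply: val_inj; rewrite /= inordK // ltnS ltnW.
case: ifP => [/existsP[j /andP[/eqP hj]]|/negbT /existsPn/(_ (inord i.+1))].
  have <- : inord i.+1 = j by rewrite -hj inord_val.
  by move=> ->.
by rewrite inordK ?ltnS // eqxx /= => /negbTE ->.
Qed.

Definition reindex_digits (b m : nat) (s : 'S_m.+1) (a : {ffun 'I_m.+1 -> 'I_b})
    : {ffun 'I_m.+1 -> 'I_b} := [ffun i => a (s i)].

Lemma reindex_digits_inj (b m : nat) (s : 'S_m.+1) :
  injective (@reindex_digits b m s).
Proof.
move=> a a' /ffunP eq_a; apply/ffunP => i.
by have := eq_a ((s^-1)%g i); rewrite !ffunE permKV.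
Qed.

(** The digit at position i of the reindexed row is the one that the shuffle
    reads for the card in position i, so sorting compares these digits first and
    breaks ties by s; the reversal then exchanges ascents and descents. *)
Lemma descent_bit_step (b m : nat) (s : 'S_m.+1) (a : {ffun 'I_m.+1 -> 'I_b})
    (i : nat) : i < m ->
  descent_bit (reversal (s * shuffle_perm a)) i =
  next_bits (descent_bit s) (reindex_digits s a) i.
Proof.
move=> im; rewrite /descent_bit /next_bits /digit !reversalE !permM !ffunE.
rewrite /shuffle_perm !permE /=.
set j := inord i; set j' := inord i.+1.
have r1 := shuffle_rank_lt a (s j); have r2 := shuffle_rank_lt a (s j').
rewrite (_ : (_ < _) = (shuffle_rank a (s j) < shuffle_rank a (s j'))); last lia.
have neq : s j != s j' :> nat.
  apply/negP => /eqP /val_inj /perm_inj /(congr1 (@nat_of_ord m.+1)).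
  by rewrite /j /j' !inordK; lia.
rewrite shuffle_rank_ltE -val_eqE /=; move: neq; lia.
Qed.

(** Taking the reindexed row x as input makes the permutations and the bits two
    recursions driven by the same sequence of rows. *)
Definition rev_shuffle_step (b m : nat) (s : 'S_m.+1)
    (x : {ffun 'I_m.+1 -> 'I_b}) : 'S_m.+1 :=
  reversal (s * shuffle_perm (reindex_digits s^-1 x))%g.

Lemma reindex_digitsK (b m : nat) (s : 'S_m.+1) (a : {ffun 'I_m.+1 -> 'I_b}) :
  reindex_digits s^-1 (reindex_digits s a) = a.
Proof. by apply/ffunP => i; rewrite !ffunE permKV. Qed.

Lemma reindex_digitsKV (b m : nat) (s : 'S_m.+1) (a : {ffun 'I_m.+1 -> 'I_b}) :
  reindex_digits s (reindex_digits s^-1 a) = a.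
Proof. by apply/ffunP => i; rewrite !ffunE permK. Qed.

Lemma descents_run (b m : nat) (x : nat -> {ffun 'I_m.+1 -> 'I_b}) (r : nat) :
  descents (run (@rev_shuffle_step b m) 1%g x r) = \sum_(i < m) bits x r i.
Proof.
rewrite descentsE; apply: eq_bigr => -[i im] _ /=; congr (nat_of_bool _).
elim: r i im => [|r IHr] i im.
  by rewrite /bits /= /descent_bit !perm1 !inordK; lia.
rewrite /bits /= descent_bit_step // reindex_digitsKV /next_bits.
by rewrite IHr.
Qed.

(** * Carries of the elementary additions *)

(** Everything that enters the first k elementary additions of a column: k + 1
    digits and the k bits from the previous column.  Reduced modulo b it is the
    digit of the k-th partial sum. *)
Definition prefix_sum (b m : nat) (c : nat -> bool)
    (y : {ffun 'I_m.+1 -> 'I_b}) (k : nat) : nat :=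
  \sum_(j < k.+1) digit y j + \sum_(j < k) c j.

Definition prefix_digits (b m : nat) (b0 : 0 < b) (c : nat -> bool)
    (y : {ffun 'I_m.+1 -> 'I_b}) : {ffun 'I_m.+1 -> 'I_b} :=
  [ffun i : 'I_m.+1 => Ordinal (ltn_pmod (prefix_sum c y i) b0)].

Lemma prefix_sumS (b m : nat) (c : nat -> bool) (y : {ffun 'I_m.+1 -> 'I_b}) k :
  prefix_sum c y k.+1 = prefix_sum c y k + (c k + digit y k.+1).
Proof. by rewrite /prefix_sum (big_ord_recr k.+1) !(big_ord_recr k) /=; lia. Qed.

Lemma prefix_digitsE (b m : nat) (b0 : 0 < b) (c : nat -> bool)
    (y : {ffun 'I_m.+1 -> 'I_b}) (k : nat) : k <= m ->
  digit (prefix_digits b0 c y) k = prefix_sum c y k %% b.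
Proof. by move=> km; rewrite /digit ffunE /= inordK. Qed.

(** The first digit of the row is its first partial sum, and each later one is
    the difference modulo b of two consecutive partial sums, up to the known
    bit. *)
Lemma prefix_digits_inj (b m : nat) (b0 : 0 < b) (c : nat -> bool) :
  injective (@prefix_digits b m b0 c).
Proof.
move=> y y' eq_yy'.
have eq_mod k : k <= m -> prefix_sum c y k = prefix_sum c y' k %[mod b].
  by move=> km; rewrite -!(prefix_digitsE b0) ?eq_yy'.
have eq_digit k : k <= m -> digit y k = digit y' k.
  have small (z : {ffun 'I_m.+1 -> 'I_b}) l : digit z l %% b = digit z l.
    by rewrite modn_small ?ltn_ord.
  case: k => [_|k km].
    have := eq_mod 0 (leq0n m).
    by rewrite /prefix_sum !big_ord_recr !big_ord0 /= !addn0 !small.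
  have /eqP := eq_mod _ km; rewrite !prefix_sumS !addnA.
  rewrite -(modnDml (_ + c k)) -[in X in _ == X](modnDml (_ + c k)).
  rewrite -(modnDml _ (c k)) -[in X in _ == X](modnDml _ (c k)).
  by rewrite (eq_mod _ (ltnW km)) eqn_modDl !small => /eqP.
apply/ffunP => i; apply: val_inj.
by have := eq_digit i (leq_ord i); rewrite /digit inord_val.
Qed.

(** The comparison detects the absence of overflow: without one the remainder
    grows by c + d, otherwise it drops by b - d below t %% b + c. *)
Lemma divn_add_carry (b t d : nat) (c : bool) : d < b ->
  (t + (c + d)) %/ b + (t %% b + c <= (t + (c + d)) %% b) = t %/ b + 1.
Proof.
move=> db; have b0 : 0 < b by lia.
have lt_mod := ltn_pmod t b0; have eq_t := divn_eq t b.
have [small|big] := ltnP (t %% b + (c + d)) b.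
  have -> : t + (c + d) = t %/ b * b + (t %% b + (c + d)) by lia.
  by rewrite divnMDl // modnMDl (divn_small small) (modn_small small); lia.
have -> : t + (c + d) = (t %/ b + 1) * b + (t %% b + (c + d) - b) by lia.
have small : t %% b + (c + d) - b < b by lia.
by rewrite divnMDl // modnMDl (divn_small small) (modn_small small); lia.
Qed.

(** Each of the k additions raises either the quotient or the number of new
    bits, by divn_add_carry. *)
Lemma prefix_quotient (b m : nat) (b0 : 0 < b) (c : nat -> bool)
    (y : {ffun 'I_m.+1 -> 'I_b}) (k : nat) : k <= m ->
  prefix_sum c y k %/ b + \sum_(i < k) next_bits c (prefix_digits b0 c y) i = k.
Proof.
elim: k => [|k IHk] km.
  rewrite /prefix_sum big_ord_recr !big_ord0 /= !addn0.
  by apply: divn_small; exact: ltn_ord.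
rewrite big_ord_recr /= [in X in _ + (_ + X)]/next_bits.
rewrite !prefix_digitsE ?(ltnW km) // prefix_sumS.
rewrite addnCA (@divn_add_carry b _ (digit y k.+1) (c k)) ?ltn_ord //.
by rewrite addn1 addnS addnC IHk ?(ltnW km).
Qed.

(** The defining relation of the carries process says that m - k' is the quotient
    by b of the full column sum, which is m minus the number of new bits. *)
Lemma neg_carries_step_bits (b m : nat) (b0 : 0 < b) (c : nat -> bool)
    (y : {ffun 'I_m.+1 -> 'I_b}) (k k' : 'I_m.+1) :
  k = \sum_(i < m) c i :> nat -> neg_carries_step k y k' ->
  k' = \sum_(i < m) next_bits c (prefix_digits b0 c y) i :> nat.
Proof.
move=> eq_k [s hs].
have sumE : k + \sum_(i < m.+1) y i = prefix_sum c y m.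
  rewrite eq_k addnC /prefix_sum; congr (_ + _).
  by apply: eq_bigr => i _; rewrite /digit inord_val.
have := prefix_quotient b0 c y (leqnn m).
have k'm := ltn_ord k'; have sb := ltn_ord s.
have -> : prefix_sum c y m = (m - k') * b + s.
  by rewrite -sumE; move: hs; rewrite subSn // mulSn; lia.
rewrite divnMDl // divn_small // addn0; lia.
Qed.

(** * The two processes as functions of uniform rows *)

(** The rows of partial-sum digits drive the bits.  They are computed from the
    added digits and the bits so far, hence the recursion is first run on the
    added digits. *)
Lemma neg_carries_uniform_rows d (T : measurableType d) (R : realType)
    (P : probability T R) (b m : nat) (kappa : nat -> T -> 'I_m.+1) :
  0 < b -> neg_carries_process b P kappa ->
  exists W : nat -> T -> {ffun 'I_m.+1 -> 'I_b}, uniform_paths P W /\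
    forall r w, kappa r w = \sum_(i < m) bits (W ^~ w) r i :> nat.
Proof.
move=> b0 [Y [iidY kappa0 kappaS]].
pose X r w : {ffun 'I_m.+1 -> 'I_b} := [ffun i => Y (r, i) w].
pose col r w :=
  run (fun c y => next_bits c (prefix_digits b0 c y)) xpred0 (X ^~ w) r.
pose W r w := prefix_digits b0 (col r w) (X r w).
have bitsW r w : bits (W ^~ w) r = col r w.
  by elim: r => //= r IHr; rewrite /bits /= -/(bits _ r) IHr.
exists W; split.
  have WE r w : W r w =
      prefix_digits b0 (run (@next_bits b m) xpred0 (W ^~ w) r) (X r w).
    by rewrite -/(bits (W ^~ w) r) bitsW.
  have unifX : uniform_paths P X := iid_uniform_rows iidY.
  exact: uniform_paths_recode (@prefix_digits_inj b m b0) WE unifX.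
move=> r w; rewrite bitsW; elim: r => [|r IHr].
  by rewrite kappa0 /col /= big1.
have [s hs] := kappaS r w.
apply: (neg_carries_step_bits b0 (y := X r w) IHr); exists s.
by under eq_bigr do rewrite ffunE.
Qed.

(** The rows are the digits of the shuffles reread in the order of the
    positions; the current permutation is determined by the previous rows. *)
Lemma rev_shuffle_uniform_rows d (T : measurableType d) (R : realType)
    (P : probability T R) (b m : nat) (sigma : nat -> T -> 'S_m.+1) :
  rev_shuffle_process b P sigma ->
  exists W : nat -> T -> {ffun 'I_m.+1 -> 'I_b}, uniform_paths P W /\
    forall r w, descents (sigma r w) = \sum_(i < m) bits (W ^~ w) r i.
Proof.
move=> [A [iidA sigma0 sigmaS]].
pose W r w := reindex_digits (sigma r w) (A r w).
have sigmaE r w : run (@rev_shuffle_step b m) 1%g (W ^~ w) r = sigma r w.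
  elim: r => [|r IHr] /=; first by rewrite sigma0.
  by rewrite IHr sigmaS /rev_shuffle_step reindex_digitsK.
exists W; split; last by move=> r w; rewrite -descents_run sigmaE.
have WE r w : W r w =
    reindex_digits (run (@rev_shuffle_step b m) 1%g (W ^~ w) r) (A r w).
  by rewrite sigmaE.
exact: uniform_paths_recode (@reindex_digits_inj b m) WE (iid_uniform_paths iidA).
Qed.

Local Close Scope nat_scope.

Theorem theorem1p9 (R : realType) (b n : nat) (hb : (2 <= b)%N) (hn : (1 <= n)%N)
  (d : measure_display) (T : measurableType d) (P : probability T R)
  (kappa : nat -> T -> 'I_n) (hkappa : neg_carries_process b P kappa)
  (d' : measure_display) (T' : measurableType d') (Q : probability T' R)
  (sigma : nat -> T' -> 'S_n) (hsigma : rev_shuffle_process b Q sigma) :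
  same_process_law P (fun r w => nat_of_ord (kappa r w))
                   Q (fun r w => descents (sigma r w)).
Proof.
case: n hn kappa hkappa sigma hsigma => [//|m] _ kappa hkappa sigma hsigma.
have [W [unifW kappaE]] := neg_carries_uniform_rows (ltnW hb) hkappa.
have [V [unifV descE]] := rev_shuffle_uniform_rows hsigma.
pose obs x r := (\sum_(i < m) @bits b m x r i)%N.
have -> : (fun r w => nat_of_ord (kappa r w)) = (fun r w => obs (W ^~ w) r).
  by apply/funext => r; apply/funext => w; exact: kappaE.
have -> : (fun r w => descents (sigma r w)) = (fun r w => obs (V ^~ w) r).
  by apply/funext => r; apply/funext => w; exact: descE.
apply: uniform_paths_same_law unifW unifV => r x y eq_xy.
by rewrite /obs /bits (eq_run _ _ eq_xy).
Qed.
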